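(* Let $D\in(0,1)$ be the fixed constant in the definition of $\mathscr{O}_\tau$ (see context) and let $c,\delta>0$ be sufficiently small constants and $\ell\ge2$. There exist large constants $C_1,C_2>0$ such that, under the model and Assumptions 1, 2, 3 of the context, if $n\ge C_1(o+\log(1/\delta)+p)$ and $$\tau=C_2\left(\frac{o+\log(1/\delta)}{n}\right)^{2/\ell},$$ then, with probability at least $1-\delta$, the convex set $$\mathscr{J}_c:=\{\beta\in\mathbb{R}^p:\ \|\beta-\beta^*\|\le c\}$$ satisfies $\mathscr{J}_c\subset\mathscr{O}_\tau$.
   Context: Model: for $i=1,\dots,n$, $Y_i=X_i^\top\beta^*+\theta_i+\xi_i$ with $X_i\in\mathbb{R}^p$, $Y_i,\theta_i,\xi_i\in\mathbb{R}$ and unknown $\beta^*\in\mathbb{R}^p$. The $\xi_i$ are independent of the $X_i$. The contamination vector $\theta=(\theta_1,\dots,\theta_n)$ is chosen by an adversary: it is a random vector that may depend arbitrarily on all the $X_i$, $\xi_i$, on $\beta^*$ and on the joint distribution. Assumption 1: $\theta$ is $o$-sparse, i.e. $\sum_{i=1}^n\mathbf{1}(\theta_i\ne0)\le o$. Assumption 2: $X_1,\dots,X_n$ are i.i.d., centered, isotropic ($\mathbf{E}(X_1X_1^\top)=I_p$) and $1$-sub-Gaussian, i.e. $\mathbf{E}\exp(\langle u,X_1\rangle)\le\exp(\|u\|^2/2)$ for all $u\in\mathbb{R}^p$. Assumption 3: $\xi_1,\dots,\xi_n$ are i.i.d., centered, with unit variance, and for some $\ell\ge2$ and $a>0$, $\mathbf{E}(|\xi_1|^\ell)\le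 a^\ell$; when $\ell=\infty$ this is replaced by $\mathbf{P}(|\xi_1|\ge t)\le 2\exp(-t^2/(2a^2))$ for $t\ge 0$. The number $a$ is bounded by a fixed constant; constants may depend on that bound (and on $D$) but on no other problem parameter. Definition: $$\mathscr{O}_\tau=\left\{\beta\in\mathbb{R}^p:\ \frac1n\sum_{i=1}^n \mathbf{1}\left\{\exp\left(-\frac{\tau (Y_i-X_i^\top\beta)^2}{2}\right)\ge \exp\left(-\frac14\right)\right\}\ge D\right\},$$ where $D$ is a constant subject to $p+2o'(1+\log(\frac{n}{2o'}))<Dn/C^2$ for a sufficiently large constant $C$, with $O=\{i:\theta_i\ne0\}$, $O'=\{i:(Y_i-X_i^\top\beta^* )^2\ge \frac{1}{2\tau}\}\cup O$, $o'=|O'|$; $x\log(\cdot/x)$ is $0$ at $x=0$. $\|\cdot\|$ is the Euclidean norm. *)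

(* Defs.v *)
From HB Require Import structures.
From mathcomp Require Import all_boot all_order all_algebra.
From mathcomp Require Import all_classical all_reals all_analysis.

Set Implicit Arguments.
Unset Strict Implicit.
Unset Printing Implicit Defensive.

Import Order.TTheory GRing.Theory Num.Theory.
Import numFieldNormedType.Exports.

Local Open Scope classical_set_scope.
Local Open Scope ring_scope.

(* R^p is represented by p.-tuple R, which carries the product (= Borel)
   sigma-algebra of the library; the norm of the type 'rV[R]_p would be the
   sup norm, hence the explicit Euclidean norm. *)
Section Euclidean.
Context {R : realType} {p : nat}.
Implicit Types u v : p.-tuple R.

Definition dot u v : R := \sum_(j < p) tnth u j * tnth v j.

Definition enorm u : R := Num.sqrt (dot u u).

Definition vsub u v : p.-tuple R := [tuple tnth u j - tnth v j | j < p].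

End Euclidean.

Section Probability.
Context {d : measure_display} {T : measurableType d} {R : realType}.
Variable P : probability T R.

Definition mutually_independent (I : finType) (F : I -> set_system T) : Prop :=
  forall (J : {set I}) (A : I -> set T), (forall i, i \in J -> F i (A i)) ->
    P (\bigcap_(i in [set` J]) A i) = (\prod_(i in J) P (A i))%E.

Definition iid d' (T' : measurableType d') (n : nat)
    (Z : 'I_n -> {RV P >-> T'}) : Prop :=
  mutually_independent
    (fun i => preimage_set_system setT (Z i) (@measurable _ T')) /\
  (forall i j (B : set T'), measurable B ->
    distribution P (Z i) B = distribution P (Z j) B).

(* [g_sigma_preimage Z] is the sigma-algebra generated by the whole family Z *)
Definition independent_families d1 d2 (T1 : measurableType d1)
    (T2 : measurableType d2) (n : nat)
    (Z1 : 'I_n -> {RV P >-> T1}) (Z2 : 'I_n -> {RV P >-> T2}) : Prop :=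
  forall A B : set T,
    g_sigma_preimage (fun i => Z1 i : T -> T1) A ->
    g_sigma_preimage (fun i => Z2 i : T -> T2) B ->
    P (A `&` B) = (P A * P B)%E.

(* A need not be known to be measurable, and P is only meaningful on measurable
   sets: "with probability at least q" is witnessed by a measurable event. *)
Definition with_probability_ge (q : R) (A : set T) : Prop :=
  exists E : set T, [/\ measurable E, E `<=` A & (q%:E <= P E)%E].

Definition sparse (n o : nat) (theta : 'I_n -> {RV P >-> R}) : Prop :=
  {ae P, forall w, (\sum_(i < n) (theta i w != 0%R) <= o)%N}.

Definition subgaussian_design (n p : nat)
    (X : 'I_n -> {RV P >-> p.-tuple R}) : Prop :=
  [/\ iid X,
      forall i (j : 'I_p), 'E_P[fun w => tnth (X i w) j]%E = 0%E,
      forall i (j k : 'I_p),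
        'E_P[(fun w => tnth (X i w) j * tnth (X i w) k)%R]%E = ((j == k)%:R)%:E &
      forall i (u : p.-tuple R),
        ('E_P[(fun w => expR (dot u (X i w)))%R]
           <= (expR (enorm u ^+ 2 / 2))%:E)%E].

Definition moment_or_tail (l : \bar R) (a : R) (z : {RV P >-> R}) : Prop :=
  match l with
  | r%:E => ('E_P[(fun w => `|z w| `^ r)%R] <= (a `^ r)%:E)%E
  | +oo%E => forall t : R, 0 <= t ->
      (P [set w | (t <= `|z w|)%R] <= (2 * expR (- (t ^+ 2 / (2 * a ^+ 2))))%:E)%E
  | -oo%E => False
  end.

Definition noise (n : nat) (l : \bar R) (a : R)
    (xi : 'I_n -> {RV P >-> R}) : Prop :=
  [/\ iid xi,
      forall i, 'E_P[xi i]%E = 0%E,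
      forall i, variance P (xi i) = 1%E &
      forall i, moment_or_tail l a (xi i)].

End Probability.

Section Sets.
Context {R : realType} {n p : nat}.

Definition response (x : 'I_n -> p.-tuple R) (betas : p.-tuple R)
    (th z : 'I_n -> R) (i : 'I_n) : R :=
  dot (x i) betas + th i + z i.

(* The requirement p + 2 o' (1 + log (n / (2 o'))) < D n / C^2 on D is not
   imposed: o', the number of indices that are contaminated or have a noise at
   least 1 / sqrt (2 tau), is random, and lower bounds on n keep it a small
   fraction of n with high probability. D is thus any element of ]0, 1[. *)
Definition O_set (D tau : R) (x : 'I_n -> p.-tuple R) (y : 'I_n -> R) :
    set (p.-tuple R) :=
  [set beta | D <= n%:R^-1 * \sum_(i < n)
     (expR (- (1 / 4)) <=
        expR (- (tau * (y i - dot (x i) beta) ^+ 2 / 2)))%R%:R].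

Definition J_set (c : R) (betas : p.-tuple R) : set (p.-tuple R) :=
  [set beta | enorm (vsub beta betas) <= c].

(* 2 / l for l in [2, +oo] *)
Definition two_over (l : \bar R) : R := if l is r%:E then 2 / r else 0.

End Sets.

(* Main.v *)
Require Import Defs.
From HB Require Import structures.
From mathcomp Require Import all_boot all_order all_algebra.
From mathcomp Require Import all_classical all_reals all_analysis.
From mathcomp Require Import measurable_realfun lra ring.
Import Order.TTheory GRing.Theory Num.Theory.
Import numFieldNormedType.Exports.
Local Open Scope classical_set_scope.
Local Open Scope ring_scope.
Set Implicit Arguments.
Unset Strict Implicit.
Unset Printing Implicit Defensive.

(* The constants may be chosen so that tau <= 1 / (8 m^2) with m large, so an
   observation is good as soon as theta_i = 0, |xi_i| < m and
   |<X_i, beta - beta*>| < m.  The first condition fails for at most o indices.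
   The second fails with probability at most 1 / m^2 (Chebyshev), hence, by a
   Chernoff bound, for few indices outside an event of probability exp(-n).
   For the third, sum_i |<X_i, v>| <= |v| |sum_i s_i X_i| for suitable signs
   s_i, so the supremum over v is controlled by the norms of the 2^n
   sub-Gaussian vectors sum_i s_i X_i; these are at most 10 n outside an event
   of probability exp(-n), by a union bound over the signs and over a lattice
   net of cardinality at most 64^p. *)

(** * Integrals of products of independent functions *)

Section IntegralFactor.
Local Open Scope ereal_scope.
Context {d d' : measure_display} {T : measurableType d}
  {T' : measurableType d'} {R : realType}.
Variables (P : probability T R) (W : T -> R) (Z : {mfun T >-> T'}).
Hypotheses (mW : measurable_fun setT W) (W0 : forall w, (0 <= W w)%R).
Hypothesis Wfin : \int[P]_w (W w)%:E \is a fin_num.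
Hypothesis WZ : forall B, measurable B ->
  \int[P]_w (W w * \1_B (Z w))%:E = \int[P]_w (W w)%:E * P (Z @^-1` B).

Import HBNNSimple.

(** A simple function is the finite sum of [y] times the indicator of its level set at [y], so [WZ]
    and linearity suffice. *)
Let factor_nnsfun (h : {nnsfun T' >-> R}) :
  \int[P]_w (W w * h (Z w))%:E =
  \int[P]_w (W w)%:E * \int[P]_w (h (Z w))%:E.
Proof.
have mI y :
    measurable_fun [set: T] (fun w => (\1_(h @^-1` [set y]) (Z w) : R)%:E).
  apply/measurable_EFinP.
  by apply: measurableT_comp => //; exact: measurable_indic.
have I0 y w : 0 <= (\1_(h @^-1` [set y]) (Z w) : R)%:E :> \bar R.
  by rewrite lee_fin.
have yge0 y : y \in range h -> (0 <= y)%R.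
  by rewrite inE => -[t _ <-].
have hE w : (h (Z w))%:E =
    \sum_(y \in range h) (y%:E * (\1_(h @^-1` [set y]) (Z w))%:E).
  by rewrite {1}fimfunE -fsumEFin.
have yI0 y w : 0 <= y%:E * (\1_(h @^-1` [set y]) (Z w))%:E.
  exact: nnfun_muleindic_ge0.
rewrite [X in _ = _ * X](_ : _ = \int[P]_w \sum_(y \in range h)
    (y%:E * (\1_(h @^-1` [set y]) (Z w))%:E)); last first.
  by apply: eq_integral => w _; exact: hE.
rewrite ge0_integral_fsum//; last by move=> y; exact: measurable_funeM.
transitivity (\int[P]_w (\sum_(y \in range h)
    (y%:E * (W w * \1_(h @^-1` [set y]) (Z w))%:E))).
  apply: eq_integral => w _; rewrite EFinM hE ge0_mule_fsumr//.
  by apply: eq_fsbigr => y _; rewrite EFinM muleCA.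
rewrite ge0_integral_fsum//; last 2 first.
- move=> y; apply: measurable_funeM; under eq_fun do rewrite EFinM.
  by apply: emeasurable_funM => //; exact/measurable_EFinP.
- by move=> y w _; rewrite EFinM muleCA mule_ge0// lee_fin.
rewrite ge0_mule_fsumr; last by move=> y; exact: integral_ge0.
apply: eq_fsbigr => y /yge0 y0.
rewrite !ge0_integralZl//; last 2 first.
- under eq_fun do rewrite EFinM.
  by apply: emeasurable_funM => //; exact/measurable_EFinP.
- by move=> w _; rewrite lee_fin mulr_ge0.
rewrite WZ//.
rewrite muleCA; congr (_ * (_ * _)).
rewrite -[in LHS](setIT (Z @^-1` _)) -integral_indic//.
by apply: measurable_funPTI.
Qed.

(** Both sides pass to the limit along increasing simple functions, by monotone convergence. [Wfin]
    makes multiplication by the integral of [W] continuous on the extended reals. *)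
Lemma integral_factor (f : T' -> R) : measurable_fun setT f ->
  (forall x, (0 <= f x)%R) ->
  \int[P]_w (W w * f (Z w))%:E =
  \int[P]_w (W w)%:E * \int[P]_w (f (Z w))%:E.
Proof.
move=> mf f0.
have mf' : measurable_fun [set: T'] (EFin \o f) by exact/measurable_EFinP.
pose h := nnsfun_approx measurableT mf'.
have hf x : (h n x)%:E @[n --> \oo] --> (f x)%:E.
  apply: (@cvg_nnsfun_approx _ _ _ setT measurableT _ mf') => // y _.
  by rewrite lee_fin.
have hnd x : {homo (fun n => (h n x)%:E) : m n / (m <= n)%N >-> m <= n}.
  by move=> m n mn; rewrite lee_fin; exact/lefP/nd_nnsfun_approx.
have mh n : measurable_fun setT (fun w => (h n (Z w))%:E).
  by apply/measurable_EFinP; apply: measurableT_comp.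
have cv1 : \int[P]_w (h n (Z w))%:E @[n --> \oo] --> \int[P]_w (f (Z w))%:E.
  have -> : \int[P]_w (f (Z w))%:E = \int[P]_w lim ((h n (Z w))%:E @[n --> \oo]).
    by apply: eq_integral => w _; apply/esym/cvg_lim.
  apply: cvg_monotone_convergence => //.
    by move=> n w _; rewrite lee_fin.
have cv2 : \int[P]_w (W w * h n (Z w))%:E @[n --> \oo] -->
    \int[P]_w (W w * f (Z w))%:E.
  have -> : \int[P]_w (W w * f (Z w))%:E =
            \int[P]_w lim ((W w * h n (Z w))%:E @[n --> \oo]).
    apply: eq_integral => w _; apply/esym/cvg_lim => //.
    under eq_fun do rewrite EFinM.
    by rewrite EFinM; apply: cvgeZl.
  apply: cvg_monotone_convergence => //.
  - move=> n; under eq_fun do rewrite EFinM.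
    by apply: emeasurable_funM => //; exact/measurable_EFinP.
  - by move=> n w _; rewrite lee_fin mulr_ge0.
  - by move=> w _ m n mn; rewrite !EFinM lee_wpmul2l ?lee_fin//; exact: hnd.
apply: (cvg_unique (@ereal_hausdorff R) cv2).
rewrite /= (eq_cvg _ _ (fun n => factor_nnsfun (h n))).
by apply: cvgeZl.
Qed.
End IntegralFactor.

Section IntegralProduct.
Local Open Scope ereal_scope.
Context {d d' : measure_display} {T : measurableType d}
  {T' : measurableType d'} {R : realType}.
Variables (P : probability T R) (n : nat) (Z : 'I_n -> {mfun T >-> T'}).
Hypothesis indepZ : mutually_independent P
  (fun i => preimage_set_system setT (Z i) (@measurable _ T')).

Let indep_indic (B : 'I_n -> set T') : (forall i, measurable (B i)) ->
  \int[P]_w (\prod_(i < n) \1_(B i) (Z i w))%:E =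
  \prod_(i < n) P (Z i @^-1` B i).
Proof.
move=> mB; have := indepZ (J := [set: 'I_n]%SET) (A := fun i => Z i @^-1` B i).
have H i : i \in [set: 'I_n]%SET ->
    preimage_set_system setT (Z i) measurable (Z i @^-1` B i).
  by move=> _; exists (B i) => //; rewrite setTI.
move=> /(_ H) {H}; rewrite (eq_bigl predT) => [<-|i]; last by rewrite inE.
rewrite -[X in P X]setIT -integral_indic//; last first.
  apply: fin_bigcap_measurable => [|i _]; first exact: finite_finset.
  by apply: measurable_funPTI.
apply: eq_integral => w _; congr (_%:E); rewrite indicE.
case: (boolP (w \in _)) => /= [|/negP].
  rewrite inE => h; rewrite big1// => i _; rewrite indicE mem_set//.
  by apply: (h i); rewrite /= inE.
rewrite inE => h; apply/eqP; rewrite prodf_seq_eq0; apply/hasP.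
have /existsNP[i /not_implyP[_ hi]] := h.
by exists i; rewrite ?mem_index_enum//= indicE memNset.
Qed.

Lemma integral_prod_indep (f : 'I_n -> T' -> R) :
  (forall i, measurable_fun setT (f i)) -> (forall i x, (0 <= f i x)%R) ->
  (forall i, \int[P]_w (f i (Z i w))%:E \is a fin_num) ->
  \int[P]_w (\prod_(i < n) f i (Z i w))%:E =
  \prod_(i < n) \int[P]_w (f i (Z i w))%:E.
Proof.
(* Independence is the case of indicators; they are replaced by the functions
   [f i] one index at a time. *)
suff H (S : {set 'I_n}) (g : 'I_n -> T' -> R) :
    (forall i, measurable_fun setT (g i)) -> (forall i x, (0 <= g i x)%R) ->
    (forall i, \int[P]_w (g i (Z i w))%:E \is a fin_num) ->
    (forall i, i \notin S -> exists2 B, measurable B & g i = \1_B) ->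
    \int[P]_w (\prod_(i < n) g i (Z i w))%:E =
    \prod_(i < n) \int[P]_w (g i (Z i w))%:E.
  by move=> mf f0 ffin; apply: (H [set: 'I_n]%SET) => // i; rewrite inE.
(* Induction on the size of [S], which contains every index where [g] is not known to be an
   indicator. *)
elim: {S}_.+1 {-2}S (ltnSn #|S|) g => [//|N IH] S SN g mg g0 gfin gS.
have [S0|[i0 i0S]] := set_0Vmem S.
  have /choice[B BE] : forall i, exists B, measurable B /\ g i = \1_B.
    by move=> i; have [|B ? ?] := gS i; [rewrite S0 inE|exists B].
  under eq_integral do under eq_bigr => i _ do rewrite (BE i).2.
  rewrite indep_indic => [|i]; last exact: (BE i).1.
  apply: eq_bigr => i _; rewrite (BE i).2 -[X in P X]setIT -integral_indic//.
  by apply: measurable_funPTI; exact: (BE i).1.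
have mgZ i : measurable_fun setT (fun w => g i (Z i w)).
  by apply: measurableT_comp.
pose W w := (\prod_(i < n | i != i0) g i (Z i w))%R.
have WE w : (\prod_(i < n) g i (Z i w) = W w * g i0 (Z i0 w))%R.
  by rewrite (bigD1 i0)//= mulrC.
(* With [\1_B] in place of [g i0], only [S] minus [i0] may carry non-indicators, so the induction
   hypothesis applies. This is the factorization on indicators that [integral_factor] asks for;
   [B = setT] then gives the integral of [W]. *)
have IHB B : measurable B -> \int[P]_w (W w * \1_B (Z i0 w))%:E =
    (\prod_(i < n | i != i0) \int[P]_w (g i (Z i w))%:E) * P (Z i0 @^-1` B).
  move=> mB; pose gB i := if i == i0 then \1_B else g i.
  have gBi0 : gB i0 = \1_B by rewrite /gB eqxx.
  have gBE i : i != i0 -> gB i = g i by rewrite /gB => /negbTE ->.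
  have gBint : \int[P]_w (gB i0 (Z i0 w))%:E = P (Z i0 @^-1` B).
    rewrite gBi0 -[X in P X]setIT -integral_indic//.
    exact: measurable_funPTI.
  have := IH (S :\ i0)%SET _ gB; rewrite (bigD1 i0)//= gBint.
  under eq_bigr => i /gBE -> do idtac.
  rewrite muleC => <-.
  - apply: eq_integral => w _; rewrite (bigD1 i0)//= gBi0 mulrC.
    congr (_ * _)%:E%R.
    by apply: eq_bigr => i /gBE ->.
  - by move: SN; rewrite (cardsD1 i0) i0S.
  - by move=> i; rewrite /gB; case: eqP => // _; exact: measurable_indic.
  - by move=> i x; rewrite /gB; case: eqP => // _; rewrite indicE.
  - move=> i; have [->|/gBE ->//] := eqVneq i i0.
    by rewrite gBint fin_num_measure//; exact: measurable_funPTI.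
  - move=> i; rewrite !inE negb_and negbK; have [->|ni] := eqVneq i i0.
      by exists B.
    by rewrite gBE//= => /gS.
have PT : P (Z i0 @^-1` setT) = 1 by rewrite preimage_setT probability_setT.
have WB : \int[P]_w (W w)%:E =
    \prod_(i < n | i != i0) \int[P]_w (g i (Z i w))%:E.
  rewrite -[RHS]mule1 -[X in _ = _ * X]PT -IHB//; apply: eq_integral => w _.
  by rewrite indicE in_setT mulr1.
under eq_integral do rewrite WE.
rewrite integral_factor//.
- by rewrite WB [RHS](bigD1 i0)//= muleC.
- rewrite /W; under eq_fun do rewrite -big_filter.
  by apply: measurable_prod => i _.
- by move=> w; apply: prodr_ge0.
- by rewrite WB; apply/prode_fin_num => i _.
- by move=> B mB; rewrite WB IHB.
Qed.
End IntegralProduct.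

(** * Cauchy-Schwarz and signed sums *)

Section EuclideanNorm.
Context {R : realType} {p : nat}.
Implicit Types u v : p.-tuple R.

Lemma dotC u v : dot u v = dot v u.
Proof. by apply: eq_bigr => j _; rewrite mulrC. Qed.

Lemma dotBr u v w : dot u (vsub v w) = dot u v - dot u w.
Proof. by rewrite -sumrB; apply: eq_bigr => j _; rewrite tnth_mktuple mulrBr. Qed.

Lemma dot_ge0 u : 0 <= dot u u.
Proof. by apply: sumr_ge0 => j _; rewrite -expr2 sqr_ge0. Qed.

Lemma sqr_enorm u : enorm u ^+ 2 = dot u u.
Proof. by rewrite sqr_sqrtr ?dot_ge0. Qed.

Lemma enorm_ge0 u : 0 <= enorm u.
Proof. exact: sqrtr_ge0. Qed.

Lemma enorm0_tnth u : enorm u = 0 -> forall j, tnth u j = 0.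
Proof.
move=> u0 j; have : dot u u == 0 by rewrite -sqr_enorm u0 expr0n.
rewrite psumr_eq0 => [/allP/(_ j (mem_index_enum _))|i _]; last first.
  by rewrite -expr2 sqr_ge0.
by rewrite mulf_eq0 orbb => /eqP.
Qed.

(** Cauchy-Schwarz: the sum of the squares of [|v| u_j - |u| v_j] is [2 |u| |v| (|u| |v| - <u, v>)].
    Zero vectors are set apart because this is divided by [|u| |v|]. *)
Lemma dot_le_enorm u v : dot u v <= enorm u * enorm v.
Proof.
have [u0|u0] := eqVneq (enorm u) 0.
  rewrite u0 mul0r /dot big1// => j _.
  by rewrite enorm0_tnth ?mul0r.
have [v0|v0] := eqVneq (enorm v) 0.
  rewrite v0 mulr0 /dot big1// => j _.
  by rewrite [X in _ * X]enorm0_tnth ?mulr0.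
have uv : 0 < enorm u * enorm v.
  by rewrite mulr_gt0// lt_def enorm_ge0 ?u0 ?v0.
have : 0 <= \sum_j (enorm v * tnth u j - enorm u * tnth v j) ^+ 2.
  by apply: sumr_ge0 => j _; exact: sqr_ge0.
rewrite (eq_bigr (fun j => enorm v ^+ 2 * (tnth u j * tnth u j) +
    enorm u ^+ 2 * (tnth v j * tnth v j) -
    (enorm u * enorm v) *+ 2 * (tnth u j * tnth v j))); last first.
  by move=> j _; ring.
rewrite sumrB big_split/= -!mulr_sumr -/(dot u u) -/(dot v v) -/(dot u v).
rewrite -!sqr_enorm => h; rewrite -(ler_pM2l uv); nra.
Qed.

Definition sign_sum n (s : 'I_n -> bool) (x : 'I_n -> p.-tuple R) : p.-tuple R :=
  [tuple \sum_(i < n) (-1) ^+ s i * tnth (x i) j | j < p].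

Lemma dot_sign_sum n (s : 'I_n -> bool) (x : 'I_n -> p.-tuple R) u :
  dot u (sign_sum s x) = \sum_(i < n) (-1) ^+ s i * dot u (x i).
Proof.
under [LHS]eq_bigr do rewrite tnth_mktuple mulr_sumr.
rewrite exchange_big; apply: eq_bigr => i _; rewrite mulr_sumr.
by apply: eq_bigr => j _; rewrite mulrCA.
Qed.

Lemma sum_norm_dot_le n (x : 'I_n -> p.-tuple R) v :
  exists s : {ffun 'I_n -> bool},
    \sum_(i < n) `|dot (x i) v| <= enorm v * enorm (sign_sum s x).
Proof.
exists [ffun i => dot (x i) v < 0].
apply: le_trans (dot_le_enorm _ _); rewrite dot_sign_sum.
by apply: ler_sum => i _; rewrite ffunE dotC normrEsign.
Qed.

End EuclideanNorm.

(** * A lattice net of the ball *)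

Section Net.
Context (R : realType) (p : nat).

(* A net of the ball of radius 2 of R^p by points of the lattice p^(-1/2) Z^p;
   coordinates are given by a sign and a modulus. *)
Definition net_index := {ffun 'I_p -> bool * 'I_(4 * p).+1}.

Definition net_point (k : net_index) : p.-tuple R :=
  [tuple (-1) ^+ (k j).1 * (k j).2%:R / Num.sqrt p%:R | j < p].

Definition in_net (k : net_index) : bool := (\sum_(j < p) (k j).2 ^ 2 <= 4 * p)%N.

Lemma enorm_net_point k : in_net k -> enorm (net_point k) ^+ 2 <= 4.
Proof.
rewrite /in_net sqr_enorm => hk.
have [p0|p0] := posnP p.
  by rewrite /dot big1// => j; move: (ltn_ord j); rewrite {2}p0.
rewrite /dot (eq_bigr (fun j => ((k j).2 ^ 2)%:R / p%:R)); last first.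
  move=> j _; rewrite tnth_mktuple -expr2 exprMn exprVn sqr_sqrtr ?ler0n//.
  by rewrite exprMn sqrr_sign mul1r natrX.
by rewrite -mulr_suml -natr_sum ler_pdivrMr ?ltr0n// -natrM ler_nat.
Qed.

(** Rounding loss in one coordinate, for [a = |z_j|], [q = sqrt p], [N = |z|] and [b] the rounded
    modulus. Summed over the [p] coordinates, the lower bound is [3/2 N - N/2 = N]. *)
Let net_coord_le (a b q N : R) : 0 <= a -> 0 < q -> 0 < N ->
  2 * q * a / N < b + 1 ->
  3 / 2 / N * a ^+ 2 - N / 2 / q ^+ 2 <= b * a / q.
Proof.
move=> a0 q0 N0 ab.
apply: (@le_trans _ _ ((2 * q * a / N - 1) * a / q)); last first.
  by rewrite ler_pM2r ?invr_gt0//; apply: ler_wpM2r => //; lra.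
(* AM-GM: [a / q <= (a^2 / N + N / q^2) / 2] *)
rewrite -subr_ge0.
have -> : (2 * q * a / N - 1) * a / q - (3 / 2 / N * a ^+ 2 - N / 2 / q ^+ 2) =
    (a * q - N) ^+ 2 / (2 * N * q ^+ 2).
  by field; rewrite gt_eqF ?gt_eqF.
by rewrite divr_ge0 ?sqr_ge0// !mulr_ge0// ?sqr_ge0 ltW.
Qed.

(** One term is enough: rounding [2 z / |z|] towards zero on the lattice gives a point of the net
    whose product with [z] is at least [|z|]. The factor 2 pays for the rounding. *)
Lemma expR_enorm_le_net (z : p.-tuple R) :
  expR (enorm z) <= \sum_(k | in_net k) expR (dot (net_point k) z).
Proof.
set N := enorm z; have N0 : 0 <= N := enorm_ge0 z.
(* The moduli of the coordinates of [2 z / |z|] in units of [p^(-1/2)]. For [z = 0] the quotient is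
   0 by convention and the chosen point is the origin. *)
pose r j : R := 2 * Num.sqrt p%:R * `|tnth z j| / N.
have r0 j : 0 <= r j by rewrite !mulr_ge0 ?invr_ge0 ?sqrtr_ge0.
pose h j := Num.truncn (r j).
have hr j : (h j)%:R <= r j by rewrite truncn_le.
have rh j : r j < (h j)%:R + 1 by rewrite natr1 truncnS_gt.
have h2 : (\sum_(j < p) h j ^ 2 <= 4 * p)%N.
  rewrite -(ler_nat R) natr_sum natrM.
  apply: (@le_trans _ _ (\sum_(j < p) 4 * p%:R / N ^+ 2 * tnth z j ^+ 2)).
    apply: ler_sum => j _; rewrite natrX.
    have -> : 4 * p%:R / N ^+ 2 * tnth z j ^+ 2 = r j ^+ 2.
      rewrite /r !exprMn exprVn (sqr_sqrtr (ler0n _ _)) real_normK ?num_real//.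
      by ring.
    by rewrite lerXn2r ?nnegrE.
  rewrite -mulr_sumr.
  have -> : \sum_(j < p) tnth z j ^+ 2 = N ^+ 2.
    by rewrite sqr_enorm; apply: eq_bigr => j _; rewrite expr2.
  have [->|NN] := eqVneq N 0.
    by rewrite expr0n/= invr0 !mulr0 mulr_ge0 ?ler0n.
  by rewrite divfK// expf_neq0.
(* A natural number is at most its square, so the range allowed for the moduli loses no point of the
   ball. *)
have h4 j : (h j < (4 * p).+1)%N.
  rewrite ltnS; apply: leq_trans h2; rewrite (bigD1 j)//=.
  apply: leq_trans (leq_addr _ _); rewrite -mulnn.
  by case: (h j) => // m; rewrite leq_pmulr.
pose k : net_index := [ffun j => (tnth z j < 0, Ordinal (h4 j))].
have kN : in_net k by rewrite /in_net; under eq_bigr do rewrite ffunE.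
rewrite (bigD1 k)//=.
apply: (@le_trans _ _ (expR (dot (net_point k) z))); last first.
  by rewrite lerDl; apply: sumr_ge0 => i _; exact: expR_ge0.
rewrite ler_expR.
have dE : dot (net_point k) z =
    \sum_(j < p) (h j)%:R * `|tnth z j| / Num.sqrt p%:R.
  apply: eq_bigr => j _; rewrite tnth_mktuple ffunE/= normrEsign.
  by ring.
have [NE|NN] := eqVneq N 0.
  rewrite NE dE; apply: sumr_ge0 => j _.
  by rewrite !mulr_ge0 ?invr_ge0 ?sqrtr_ge0 ?ler0n.
have Np : 0 < N by rewrite lt_def NN.
have [p0|p0] := posnP p.
  move: NN; rewrite /N /enorm /dot big1 ?sqrtr0 ?eqxx// => j.
  by move: (ltn_ord j); rewrite {2}p0.
have sp : 0 < Num.sqrt p%:R :> R by rewrite sqrtr_gt0 ltr0n.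
apply: (@le_trans _ _ (\sum_(j < p) (3 / 2 / N * tnth z j ^+ 2 - N / 2 / p%:R))).
  rewrite sumrB -mulr_sumr sumr_const card_ord -[X in _ - X]mulr_natr.
  have -> : \sum_(j < p) tnth z j ^+ 2 = N ^+ 2.
    by rewrite sqr_enorm; apply: eq_bigr => j _; rewrite expr2.
  have pn : p%:R != 0 :> R by rewrite pnatr_eq0 -lt0n.
  rewrite divfK// expr2 mulrA divfK//; lra.
rewrite dE; apply: ler_sum => j _.
have pE : p%:R = Num.sqrt p%:R ^+ 2 :> R by rewrite sqr_sqrtr ?ler0n.
rewrite {1}pE -[tnth z j ^+ 2]real_normK ?num_real//.
by apply: net_coord_le => //; exact: rh.
Qed.

(** Counting by weights: on the net the moduli sum to at most [4 p], so [16^p] times the product of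
    the [2^(-modulus)] is at least 1. Over all indices this weight factorizes, and each coordinate
    contributes at most [16 * 2 * 2 = 64]. *)
Lemma card_net_le : (#|[pred k | in_net k]| <= 64 ^ p)%N.
Proof.
rewrite -(ler_nat R) natrX -sum1_card natr_sum.
apply: (@le_trans _ _ (\sum_(k : net_index)
    16 ^+ p * \prod_(j < p) 2^-1 ^+ (k j).2)).
  apply: (@le_trans _ _ (\sum_(k : net_index | in_net k)
      16 ^+ p * \prod_(j < p) 2^-1 ^+ (k j).2)).
    apply: ler_sum => k; rewrite inE => hk.
    rewrite -expr_sum exprVn ler_pdivlMr ?exprn_gt0// mul1r.
    rewrite -[16]/((2 ^ 4)%:R) natrX -exprM ler_eXn2l ?ltr1n//.
    apply: leq_trans hk; apply: leq_sum => j _; rewrite -mulnn.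
    by case: (nat_of_ord (k j).2) => // m; rewrite leq_pmulr.
  rewrite [leRHS](bigID in_net)/= lerDl; apply: sumr_ge0 => k _.
  by rewrite mulr_ge0 ?exprn_ge0//; apply: prodr_ge0 => j _; rewrite exprn_ge0.
rewrite -mulr_sumr.
rewrite -(bigA_distr_bigA
  (fun (j : 'I_p) (c : bool * 'I_(4 * p).+1) => 2^-1 ^+ c.2)) /=.
rewrite prodr_const card_ord -exprMn.
have H m : \sum_(i < m) (2^-1 : R) ^+ i = 2 - 2 * 2^-1 ^+ m.
  elim: m => [|m IH]; first by rewrite big_ord0 expr0 mulr1 subrr.
  by rewrite big_ord_recr /= IH exprS; lra.
apply: lerXn2r; rewrite ?nnegrE.
- by rewrite mulr_ge0//; apply: sumr_ge0 => c _; rewrite exprn_ge0.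
- by [].
rewrite -(pair_big xpredT xpredT
  (fun (_ : bool) (c : 'I_(4 * p).+1) => (2^-1 : R) ^+ c))/=.
rewrite sumr_const card_bool H.
have : 0 <= (2^-1 : R) ^+ (4 * p).+1 by rewrite exprn_ge0.
lra.
Qed.

End Net.

(** * Exponential moments of independent sums, and Markov's inequality *)

Lemma measurable_ge_cst {d : measure_display} {T : measurableType d}
    {R : realType} (f : T -> R) (b : R) :
  measurable_fun setT f -> measurable [set w | b <= f w].
Proof.
move=> mf; rewrite [X in measurable X](_ : _ = f @^-1` `[b, +oo[).
  by have := mf measurableT _ (measurable_itv `[b, +oo[); rewrite setTI.
by apply/seteqP; split => w /=; rewrite in_itv/= andbT.
Qed.

Lemma measurable_norm_ge {R : realType} (m : R) :
  measurable_fun [set: R] (fun x : R => (m <= `|x|)%R%:R : R).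
Proof.
rewrite (_ : (fun x => _) = \1_[set x : R | m <= `|x|]).
  apply: measurable_indic; apply: measurable_ge_cst; exact: normr_measurable.
apply/funext => x; rewrite indicE; congr (nat_of_bool _)%:R.
by apply/idP/idP; rewrite inE.
Qed.

Lemma integral_expR_sum_indep_le {d d' : measure_display}
    {T : measurableType d} {T' : measurableType d'} {R : realType}
    (P : probability T R) (n : nat) (Z : 'I_n -> {mfun T >-> T'})
    (g : 'I_n -> T' -> R) (c : R) :
  mutually_independent P
    (fun i => preimage_set_system setT (Z i) (@measurable _ T')) ->
  (forall i, measurable_fun setT (g i)) ->
  (forall i, \int[P]_w (expR (g i (Z i w)))%:E <= (expR c)%:E)%E ->
  (\int[P]_w (expR (\sum_(i < n) g i (Z i w)))%:E <= (expR (n%:R * c))%:E)%E.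
Proof.
move=> indepZ mg gc.
have gfin i : (\int[P]_w (expR (g i (Z i w)))%:E)%E \is a fin_num.
  rewrite ge0_fin_numE; first exact: le_lt_trans (gc i) (ltry _).
  by apply: integral_ge0 => w _; rewrite lee_fin expR_ge0.
under eq_integral do rewrite expR_sum.
rewrite (integral_prod_indep indepZ (f := fun i x => expR (g i x)))//; last first.
  by move=> i; apply: measurableT_comp.
rewrite expRM_natl -[X in expR c ^+ X]card_ord -prodr_const.
rewrite (eq_bigr _ (fun i _ => esym (fineK (gfin i)))).
rewrite prodEFin lee_fin; apply: ler_prod => i _.
rewrite -!lee_fin fineK// gc andbT.
by apply: integral_ge0 => w _; rewrite lee_fin expR_ge0.
Qed.

Lemma markov_expR {d : measure_display} {T : measurableType d} {R : realType}
    (P : probability T R) (f : T -> R) (b c : R) :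
  measurable_fun setT f -> (forall w, 0 <= f w) ->
  (\int[P]_w (f w)%:E <= (expR c)%:E)%E ->
  (P [set w | (expR b <= f w)%R] <= (expR (c - b))%:E)%E.
Proof.
move=> mf f0 fc.
have mA := measurable_ge_cst (expR b) mf.
rewrite addrC expRD EFinM expRN lee_pdivlMl ?expR_gt0//.
apply: le_trans fc; rewrite -[X in P X]setIT -integral_indic// -ge0_integralZl//.
  apply: ge0_le_integral => //.
  - by apply: measurable_funeM; exact/measurable_EFinP.
  - exact/measurable_EFinP.
  - move=> w _; rewrite -EFinM lee_fin indicE.
    by case: (boolP (w \in _)) => [|_]; rewrite ?mulr0// mulr1 inE.
exact/measurable_EFinP.
Qed.

(** * Uniform control of the projections of the design *)

Section Design.
Context {d : measure_display} {T : measurableType d} {R : realType}.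
Variables (P : probability T R) (n p : nat) (X : 'I_n -> {RV P >-> p.-tuple R}).
Hypothesis subX : subgaussian_design X.

(** Dominates the exponential of the norm of every signed sum at once, so that a single Markov
    inequality replaces the union bound over signs and net. *)
Definition net_sum (x : 'I_n -> p.-tuple R) : R :=
  \sum_(s : {ffun 'I_n -> bool}) \sum_(k : net_index p | in_net k)
    expR (dot (net_point R k) (sign_sum s x)).

Lemma measurable_dot (u : p.-tuple R) : measurable_fun [set: p.-tuple R] (dot u).
Proof.
apply: measurable_sum => j; apply: measurable_funM => //.
exact: measurable_tnth.
Qed.

(** The hypothesis does not involve [v]: one event serves all directions. *)
Lemma sum_norm_dot_net (x : 'I_n -> p.-tuple R) (v : p.-tuple R) (K : R) :
  net_sum x <= expR K -> \sum_(i < n) `|dot (x i) v| <= enorm v * K.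
Proof.
move=> xK; have [s hs] := sum_norm_dot_le x v.
apply: le_trans hs _; apply: ler_wpM2l; first exact: enorm_ge0.
rewrite -ler_expR; apply: le_trans (expR_enorm_le_net _) _.
apply: le_trans xK; rewrite /net_sum [leRHS](bigD1 s)//= lerDl.
by apply: sumr_ge0 => t _; apply: sumr_ge0 => k _; exact: expR_ge0.
Qed.

Let m_term (s : {ffun 'I_n -> bool}) (k : net_index p) : measurable_fun setT
  (fun w => expR (dot (net_point R k) (sign_sum s (X ^~ w)))).
Proof.
apply: measurableT_comp => //; under eq_fun do rewrite dot_sign_sum.
apply: measurable_sum => i; apply: measurable_funM => //.
by apply: measurableT_comp => //; exact: measurable_dot.
Qed.

Lemma measurable_net_sum : measurable_fun setT (fun w => net_sum (X ^~ w)).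
Proof.
apply: measurable_sum => s; under eq_fun do rewrite -big_filter.
by apply: measurable_sum => k.
Qed.

(** Net points have squared norm at most 4, so each observation contributes a factor at most [exp 2]
    and each term has mean at most [exp (2 n)]. There are at most [2^n 64^p <= 2^(7 n) <= exp (7 n)]
    terms. *)
Lemma integral_net_sum_le : (p <= n)%N ->
  (\int[P]_w (net_sum (X ^~ w))%:E <= (expR (9 * n%:R))%:E)%E.
Proof.
move=> pn; have [[indepX _] _ _ mgf] := subX.
have term_le s k : in_net k ->
    (\int[P]_w (expR (dot (net_point R k) (sign_sum s (X ^~ w))))%:E <=
     (expR (n%:R * 2))%:E)%E.
  move=> hk; under eq_integral do rewrite dot_sign_sum.
  apply: (integral_expR_sum_indep_le
    (g := fun i x => (-1) ^+ s i * dot (net_point R k) x)) => //.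
    by move=> i; apply: measurable_funM => //; exact: measurable_dot.
  move=> i.
  (* The sign is absorbed into the net point, which keeps its norm. *)
  pose u : p.-tuple R := [tuple (-1) ^+ s i * tnth (net_point R k) j | j < p].
  have uE x : (-1) ^+ s i * dot (net_point R k) x = dot u x.
    rewrite /dot mulr_sumr; apply: eq_bigr => j _.
    by rewrite [tnth u _]tnth_mktuple mulrA.
  under eq_integral do rewrite uE.
  have := mgf i u; rewrite unlock => /le_trans; apply.
  rewrite lee_fin ler_expR.
  have -> : enorm u ^+ 2 = enorm (net_point R k) ^+ 2.
    rewrite !sqr_enorm; apply: eq_bigr => j _.
    rewrite [tnth u _]tnth_mktuple -!expr2.
    by rewrite exprMn sqrr_sign mul1r.
  by have := enorm_net_point R hk; lra.
pose e : R := expR (n%:R * 2).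
apply: (@le_trans _ _ (\sum_(s : {ffun 'I_n -> bool})
    \sum_(k : net_index p | in_net k) e)%:E).
  under eq_integral do rewrite /net_sum -sumEFin.
  rewrite ge0_integral_sum//; last 2 first.
  - move=> s; apply/measurable_EFinP; under eq_fun do rewrite -big_filter.
    by apply: measurable_sum => k.
  - by move=> s w _; rewrite lee_fin; apply: sumr_ge0 => k _; exact: expR_ge0.
  rewrite -sumEFin; apply: lee_sum => s _.
  under eq_integral do rewrite -sumEFin -big_filter.
  rewrite ge0_integral_sum//; last by move=> k; apply/measurable_EFinP.
  by rewrite big_filter -sumEFin; apply: lee_sum => k; exact: term_le.
rewrite lee_fin !sumr_const cardT -cardE card_ffun card_bool card_ord.
rewrite -mulrnA -[e *+ _]mulr_natr.
have e2 : 2 <= expR 1 :> R by have := expR_ge1Dx (1 : R); lra.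
have h : (#|[pred k : net_index p | in_net k]| * 2 ^ n)%:R <=
    expR (7 * n%:R) :> R.
  apply: (@le_trans _ _ (2 ^+ (7 * n))).
    rewrite -natrX ler_nat (_ : 7 * n = 6 * n + n)%N; last by rewrite -mulSnr.
    rewrite expnD leq_mul2r; apply/orP; right.
    apply: leq_trans (card_net_le R p) _.
    by rewrite -[64%N]/(2 ^ 6)%N -expnM leq_exp2l// leq_mul2l pn orbT.
  have -> : 7 * n%:R = (7 * n)%:R * 1 :> R by rewrite mulr1 natrM.
  rewrite expRM_natl; by apply: lerXn2r e2; rewrite nnegrE ?expR_ge0.
apply: (@le_trans _ _ (e * expR (7 * n%:R))).
  by rewrite ler_wpM2l// expR_ge0.
by rewrite /e -expRD ler_expR; lra.
Qed.

Lemma design_tail : (p <= n)%N ->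
  (P [set w | (expR (10 * n%:R) <= net_sum (X ^~ w))%R] <= (expR (- n%:R))%:E)%E.
Proof.
move=> pn; have -> : - n%:R = 9 * n%:R - 10 * n%:R :> R by ring.
apply: markov_expR; [exact: measurable_net_sum| |exact: integral_net_sum_le].
by move=> w; apply: sumr_ge0 => s _; apply: sumr_ge0 => k _; exact: expR_ge0.
Qed.

End Design.

(** * The number of large noise values *)

Section Noise.
Context {d : measure_display} {T : measurableType d} {R : realType}.
Variables (P : probability T R) (n : nat) (xi : 'I_n -> {RV P >-> R}).
Hypothesis indepxi : mutually_independent P
  (fun i => preimage_set_system setT (xi i) (@measurable _ R)).
Hypothesis xi_mean : forall i, 'E_P[xi i]%E = 0%E.
Hypothesis xi_var : forall i, variance P (xi i) = 1%E.

(** Chernoff bound with parameter [l = 2 / eps]. The level [m = exp (1 / eps)] is such that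
    [m^(-2) = exp (- l)], which balances Chebyshev's bound: each factor has mean at most
    [1 + exp l * m^(-2) = 2 <= exp 1]. The threshold becomes [l * eps * n = 2 n], against a moment
    [exp n]. *)
Lemma noise_tail (eps : R) : 0 < eps ->
  (P [set w | (eps * n%:R <= \sum_(i < n) (expR eps^-1 <= `|xi i w|)%R%:R)%R]
    <= (expR (- n%:R))%:E)%E.
Proof.
move=> e0; pose m : R := expR eps^-1; pose l : R := 2 / eps.
have m0 : 0 < m := expR_gt0 _.
pose B : set R := [set x | m <= `|x|].
have mB : measurable B.
  by apply: measurable_ge_cst; exact: normr_measurable.
have PB i : (P (xi i @^-1` B) <= (m ^- 2)%:E)%E.
  have := chebyshev (xi i) m0; rewrite xi_var mule1 xi_mean/=.
  by under eq_set do rewrite subr0.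
pose g (i : 'I_n) (x : R) : R := l * (m <= `|x|)%R%:R.
have gE i x : g i x = l * \1_B x.
  rewrite /g indicE; congr (_ * (nat_of_bool _)%:R).
  by apply/idP/idP; rewrite inE.
have mg i : measurable_fun setT (g i).
  by apply: measurable_funM => //; exact: measurable_norm_ge.
have step i : (\int[P]_w (expR (g i (xi i w)))%:E <= (expR 1)%:E)%E.
  have mI : measurable_fun setT (fun w => (expR l * \1_(xi i @^-1` B) w)%:E).
    apply/measurable_EFinP; apply: measurable_funM => //.
    by apply: measurable_indic; exact: measurable_funPTI.
  (* The exponential of [l] times an indicator is at most 1 plus [exp l] times this indicator. *)
  apply: (@le_trans _ _ (\int[P]_w (1 + (expR l * \1_(xi i @^-1` B) w)%:E))%E).
    apply: ge0_le_integral => //.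
    - by apply/measurable_EFinP; do 2 apply: measurableT_comp => //.
    - exact: emeasurable_funD.
    - move=> w _; rewrite -EFinD lee_fin gE.
      rewrite -[\1_(_ @^-1` _) w]/(\1_B (xi i w) : R) indicE.
      by case: (_ \in _); rewrite ?mulr1 ?mulr0 ?expR0 ?addr0// lerDr.
  rewrite ge0_integralD//.
  rewrite integral_cst// mul1e [X in (X + _)%E](probability_setT P).
  under eq_integral do rewrite EFinM.
  rewrite ge0_integralZl//; last first.
    by apply/measurable_EFinP; apply: measurable_indic; exact: measurable_funPTI.
  rewrite integral_indic//; last exact: measurable_funPTI.
  rewrite setIT; apply: (@le_trans _ _ (1 + (expR l)%:E * (m ^- 2)%:E)%E).
    by apply: leeD2l; apply: lee_wpmul2l => //; exact: PB.
  have -> : m ^- 2 = (expR l)^-1.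
    by congr (_^-1); rewrite -expRM_natl /l mulrC.
  rewrite -EFinM divff ?gt_eqF ?expR_gt0// lee_fin.
  by have := expR_ge1Dx (1 : R); lra.
have mS : measurable_fun setT (fun w => expR (\sum_(i < n) g i (xi i w))).
  apply: measurableT_comp => //; apply: measurable_sum => i.
  exact: (measurableT_comp (mg i)).
have h := markov_expR (2 * n%:R) mS (fun w => expR_ge0 _)
  (integral_expR_sum_indep_le indepxi mg step).
have -> : - n%:R = n%:R * 1 - 2 * n%:R :> R by ring.
apply: le_trans h.
rewrite le_eqVlt; apply/orP; left; apply/eqP; congr (P _).
apply: eq_set => w; rewrite ler_expR -mulr_sumr.
have -> : 2 * n%:R = l * (eps * n%:R) by rewrite /l; field; rewrite gt_eqF.
by rewrite ler_pM2l// divr_gt0.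
Qed.

End Noise.

(** Contamination, large noise and large projections each spoil at most [eps n] indices, the last by
    Markov's inequality for the counting measure. Elsewhere the residual is at most [2 m], so [tau]
    times its square, halved, is at most [2 tau m^2 <= 1/4]. *)
Lemma O_set_small_residuals {R : realType} (n p : nat) (x : 'I_n -> p.-tuple R)
    (betas beta : p.-tuple R) (th z : 'I_n -> R) (eps m tau : R) :
  (0 < n)%N -> 0 < m -> 0 <= tau -> tau * (8 * m ^+ 2) <= 1 ->
  \sum_(i < n) (th i != 0)%:R <= eps * n%:R ->
  \sum_(i < n) (m <= `|z i|)%R%:R <= eps * n%:R ->
  \sum_(i < n) `|dot (x i) (vsub beta betas)| <= eps * n%:R * m ->
  O_set (1 - 3 * eps) tau x (response x betas th z) beta.
Proof.
move=> n0 m0 t0 tm hth hz hx; rewrite /O_set /=.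
rewrite [leRHS]mulrC ler_pdivlMr ?ltr0n//.
(* A lower bound for the indicator of a good index: at most 1, and nonpositive once one of the three
   conditions fails. *)
pose F i : R := 1 - (th i != 0)%:R - (m <= `|z i|)%R%:R -
  `|dot (x i) (vsub beta betas)| / m.
apply: (@le_trans _ _ (\sum_(i < n) F i)).
  rewrite !sumrB -mulr_suml sumr_const card_ord -[1 *+ n]/(n%:R).
  have : (\sum_(i < n) `|dot (x i) (vsub beta betas)|) / m <= eps * n%:R.
    by rewrite ler_pdivrMr.
  by move: hth hz; set a := \sum_(i < n) _; set b := \sum_(i < n) _; lra.
apply: ler_sum => i _; rewrite /F; set y := dot (x i) (vsub beta betas).
have ym0 : 0 <= `|y| / m by rewrite divr_ge0// ltW.
set good := expR (- (1 / 4)) <= _.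
have good0 : 0 <= good%:R :> R by [].
have zm0 : 0 <= (m <= `|z i|)%R%:R :> R by [].
have [thi|thi] := eqVneq (th i) 0; last by rewrite mulr1n; lra.
have [zm|zm] := leP m `|z i|; first by rewrite mulr0n mulr1n; lra.
have [ym|ym] := leP m `|y|.
  have : 1 <= `|y| / m by rewrite ler_pdivlMr// mul1r.
  by rewrite mulr0n; lra.
suff -> : good by rewrite mulr0n mulr1n; lra.
rewrite /good ler_expR lerN2.
have -> : response x betas th z i - dot (x i) beta = z i - y.
  by rewrite /response thi /y dotBr; ring.
have r2 : (z i - y) ^+ 2 <= 4 * m ^+ 2.
  have -> : 4 * m ^+ 2 = (2 * m) ^+ 2 by ring.
  rewrite -[leLHS]real_normK ?num_real//; apply: lerXn2r.
  - by rewrite nnegrE.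
  - by rewrite nnegrE mulr_ge0// ltW.
  - by apply: le_trans (ler_normB _ _) _; lra.
have := ler_wpM2l t0 r2; lra.
Qed.

(** * Choice of the constants and of the good event *)

Theorem proposition1 (R : realType) (D abar : R) (D01 : 0 < D < 1)
    (abar_gt0 : 0 < abar) :
  exists c0 delta0 C1 C2 : R,
  [/\ 0 < c0, 0 < delta0, 0 < C1 & 0 < C2] /\
  forall (c delta : R) (l : \bar R) (a : R),
    0 < c <= c0 -> 0 < delta <= delta0 -> (2%:E <= l)%E -> 0 < a <= abar ->
  forall (n p o : nat) (tau : R),
    C1 * (o%:R + ln (1 / delta) + p%:R) <= n%:R ->
    tau = C2 * ((o%:R + ln (1 / delta)) / n%:R) `^ (two_over l) ->
  forall (d : measure_display) (T : measurableType d) (P : probability T R)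
    (betas : p.-tuple R) (X : 'I_n -> {RV P >-> p.-tuple R})
    (theta xi : 'I_n -> {RV P >-> R}),
    independent_families xi X ->
    sparse o theta ->
    subgaussian_design X ->
    noise l a xi ->
  with_probability_ge P (1 - delta)
    [set w | J_set c betas `<=`
       O_set D tau (X ^~ w)
         (response (X ^~ w) betas (theta ^~ w) (xi ^~ w))].
Proof.
have /andP[D0 D1] := D01.
(* The three kinds of bad indices share the fraction [1 - D]; [m] is the level of [noise_tail]. *)
pose eps : R := (1 - D) / 3; pose m : R := expR eps^-1.
have eps0 : 0 < eps by rewrite /eps; lra.
have m0 : 0 < m := expR_gt0 _.
have epsm : 1 <= eps * m.
  rewrite -ler_pdivrMl// mulr1.
  by have := expR_ge1Dx eps^-1; rewrite -/m; lra.
have epsV : 0 < eps^-1 by rewrite invr_gt0.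
(* [1 / 10] offsets the [10 n] of [design_tail]. In [C1], the 2 gives [p <= n] and
   [exp (- n) <= delta^2 <= delta / 2], and [eps^-1] gives [o <= eps n]. [C2] gives
   [8 tau m^2 <= 1]. *)
exists (1 / 10), (1 / 2), (2 + eps^-1), ((8 * m ^+ 2)^-1); split.
  by split; [lra|lra|lra|rewrite invr_gt0 mulr_gt0// exprn_gt0].
move=> c delta l a /andP[c_gt0 cle] /andP[delta0 deltale] l2 _.
move=> n p o tau nlarge tauE.
move=> d T P betas X theta xi _ spar subX [[indepxi _] xi_mean xi_var _].
pose L : R := ln (1 / delta).
have L0 : 0 < L by apply: ln_gt0; rewrite ltr_pdivlMr// mul1r; lra.
have on0 : 0 <= o%:R :> R := ler0n _ _.
have pn0 : 0 <= p%:R :> R := ler0n _ _.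
have hlarge : 2 * (o%:R + L + p%:R) + eps^-1 * (o%:R + L + p%:R) <= n%:R.
  by rewrite -mulrDl.
have tpos : 0 <= eps^-1 * (L + p%:R) by rewrite mulr_ge0 ?addr_ge0// ltW.
have n0R : 0 < n%:R :> R.
  have : 0 <= eps^-1 * o%:R by rewrite mulr_ge0// ltW.
  by move: hlarge; rewrite -addrA [eps^-1 * _]mulrDr; lra.
have n0 : (0 < n)%N by rewrite -(ltr0n R).
have e0 : 0 <= eps^-1 * (o%:R + L + p%:R) by rewrite mulr_ge0 ?addr_ge0// ltW.
have on : o%:R <= eps * n%:R.
  rewrite -ler_pdivrMl//; move: hlarge.
  by rewrite -[X in eps^-1 * X]addrA [eps^-1 * (_ + (_ + _))]mulrDr; lra.
have pn : (p <= n)%N by rewrite -(ler_nat R); lra.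
have tau_ge0 : 0 <= tau.
  by rewrite tauE mulr_ge0 ?powR_ge0// invr_ge0 mulr_ge0// exprn_ge0// ltW.
have tau_le : tau * (8 * m ^+ 2) <= 1.
  have C0 : 0 < 8 * m ^+ 2 by rewrite mulr_gt0// exprn_gt0.
  rewrite tauE -/L mulrAC mulVf ?gt_eqF// mul1r.
  (* The base lies in []0, 1]] and the exponent is nonnegative (0 when [l] is infinite), so the
     power is at most 1. *)
  rewrite -[leRHS](powRr0 ((o%:R + L) / n%:R)); apply: ger_powR.
    by rewrite divr_gt0 ?ler_pdivrMr//; lra.
  rewrite /two_over; case: (l) l2 => [r| |]//; rewrite lee_fin => r2.
  by apply: divr_ge0; lra.
have exp_le : expR (- n%:R) <= delta / 2.
  apply: (@le_trans _ _ (expR (2%:R * - L))); first by rewrite ler_expR; lra.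
  have -> : - L = ln delta by rewrite /L div1r lnV ?opprK// posrE.
  by rewrite expRM_natl lnK ?posrE//; nra.
have [N [mN PN0 Nsparse]] := spar.
pose B1 := [set w | expR (10 * n%:R) <= net_sum (X ^~ w)].
pose B2 := [set w | eps * n%:R <= \sum_(i < n) (m <= `|xi i w|)%R%:R].
have mB1 : measurable B1.
  by apply: measurable_ge_cst; exact: measurable_net_sum.
have mB2 : measurable B2.
  apply: measurable_ge_cst; apply: measurable_sum => i.
  exact: (measurableT_comp (measurable_norm_ge m)).
have mB : measurable (N `|` (B1 `|` B2)) by do 2 apply: measurableU => //.
(* None of the three exceptional sets depends on [beta], so the inclusion holds for the whole ball
   at once. *)
exists (~` (N `|` (B1 `|` B2))); split.
- exact: measurableC.
- move=> w; rewrite !setCU => -[Nw [/negP B1w /negP B2w]] beta hbeta.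
  have -> : D = 1 - 3 * eps by rewrite /eps; lra.
  apply: (O_set_small_residuals (m := m)) => //.
  + apply: le_trans on; rewrite -natr_sum ler_nat.
    by apply: contrapT => h; apply: Nw; apply: Nsparse.
  + by move: B2w; rewrite -ltNge => /ltW.
  (* The chain is [c * 10 n <= n <= eps m n], the last inequality by [epsm]. *)
  + apply: (@le_trans _ _ (enorm (vsub beta betas) * (10 * n%:R))).
      by apply: sum_norm_dot_net; move: B1w; rewrite -ltNge => /ltW.
    rewrite mulrAC.
    apply: (@le_trans _ _ (1 * n%:R)); last by rewrite ler_pM2r.
    by rewrite mulrA ler_pM2r//; move: hbeta; rewrite /J_set /=; lra.
- rewrite probability_setC// EFinB leeB//.
  apply: le_trans (measureU2 _ _ _) _ => //; first exact: measurableU.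
  rewrite [X in (X + _)%E]PN0 add0e.
  apply: le_trans (measureU2 _ _ _) _ => //.
  apply: (@le_trans _ _ ((expR (- n%:R))%:E + (expR (- n%:R))%:E)%E).
    apply: leeD; first exact: design_tail.
    exact: noise_tail.
  by rewrite -EFinD lee_fin; lra.
Qed.
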